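(* Let $A_1,\dots,A_m$ be real $n\times n$ matrices with non-negative entries. Then $$\frac{1}{m}\,\rho\Big(\sum_{i=1}^m A_i\Big)\;\le\;\rho(A_1,\dots,A_m)\;\le\;\rho\Big(\sum_{i=1}^m A_i\Big).$$
   Context: For a single real square matrix $A$, $\rho(A)=\lim_{k\to\infty}\|A^k\|^{1/k}$ is the spectral radius (the largest modulus of an eigenvalue). For a finite set of real $n\times n$ matrices the joint spectral radius is $$\rho(A_1,\dots,A_m)=\limsup_{k\to+\infty}\ \max_{\sigma\in\{1,\dots,m\}^k}\|A_\sigma\|^{1/k},\qquad A_\sigma=A_{\sigma_k}\cdots A_{\sigma_2}A_{\sigma_1},$$ where $\|\cdot\|$ is any matrix norm (the value does not depend on the choice). *)

(* Defs.v *)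
From mathcomp Require Import all_boot all_order all_algebra.
From mathcomp Require Import all_classical all_reals all_analysis.
Import Order.TTheory GRing.Theory Num.Theory.
Import numFieldNormedType.Exports.

Set Implicit Arguments.
Unset Strict Implicit.
Unset Printing Implicit Defensive.

Local Open Scope classical_set_scope.
Local Open Scope ring_scope.

(* An arbitrary vector-space norm; submultiplicativity is not required.
   Non-negativity of N follows from the three conditions. *)
Definition is_mxnorm (R : realType) (n : nat) (N : 'M[R]_n -> R) : Prop :=
  [/\ forall A B : 'M[R]_n, N (A + B) <= N A + N B,
      forall (a : R) (A : 'M[R]_n), N (a *: A) = `|a| * N A
    & forall A : 'M[R]_n, N A = 0 -> A = 0].

Definition spectral_radius (R : realType) (n : nat) (N : 'M[R]_n -> R)
    (A : 'M[R]_n) : R :=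
  limn (fun k : nat => N (A ^+ k) `^ k%:R^-1).

(* The list is reversed because the first letter of the word is the rightmost
   factor: A_s = A_(s_k) * ... * A_(s_2) * A_(s_1). *)
Definition word_prod (R : realType) (n m : nat) (A : 'I_m -> 'M[R]_n)
    (s : seq 'I_m) : 'M[R]_n :=
  \prod_(i <- rev s) A i.

(* The default value 0 of the maximum is harmless: all terms are
   non-negative, and there is at least one word when m > 0. *)
Definition joint_spectral_radius (R : realType) (n m : nat)
    (N : 'M[R]_n -> R) (A : 'I_m -> 'M[R]_n) : R :=
  limn_sup (fun k : nat =>
    \big[Num.max/0]_(s : k.-tuple 'I_m) (N (word_prod A s) `^ k%:R^-1)).

(* Main.v *)
Require Import Defs.
From mathcomp Require Import all_boot all_order all_algebra.
From mathcomp Require Import all_classical all_reals all_analysis.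
Import Order.TTheory GRing.Theory Num.Theory.
Import numFieldNormedType.Exports.
Set Implicit Arguments.
Unset Strict Implicit.
Unset Printing Implicit Defensive.
Local Open Scope classical_set_scope.
Local Open Scope ring_scope.

(** Write S for the sum of the matrices A_i. Expanding the power S^k without
commutativity gives the sum of the products A_s over all words s of length k
([expr_sum_words]). This yields both inequalities at level k, before any
limit is taken.

- By the triangle inequality, N(S^k) is at most the sum of m^k terms N(A_s),
  hence at most m^k times the largest of them; after taking k-th roots the
  factor m^k becomes m.
- Since the A_i are non-negative, each A_s is entrywise between 0 and S^k.
  A norm need not be monotone on non-negative matrices, but it is comparable
  with the largest absolute value of an entry, which is. So
  N(A_s) <= c * N(S^k) with c independent of k ([mxnorm_monotone]), and the
  k-th root of c tends to 1.

It remains to pass to the limit. An upper limit is a monotone function of a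
bounded sequence ([le_limn_sup]). The spectral radius, however, is a plain
limit, and this limit has to be shown to exist: N is submultiplicative up to a
constant c ([mxnorm_mulmx]), so k |-> c * N(S^k) is submultiplicative and its
k-th roots converge by Fekete's argument ([submult_root_is_cvg]); the factor c
again disappears in the limit.

The two comparisons with the largest-entry norm rest on the equivalence of
norms in finite dimension: one inequality comes from expanding a matrix in
elementary matrices ([mxnorm_le_mx_norm]), the other from the positive minimum
of N on the compact unit sphere ([mx_norm_le_mxnorm]). *)

(** * k-th roots of sequences, and upper limits *)

Section Roots.
Variable R : realType.
Implicit Types (x y c : R) (u v : nat -> R) (k : nat).

Lemma ler_root k x y : 0 <= x -> x <= y -> x `^ k%:R^-1 <= y `^ k%:R^-1.
Proof.
move=> x0 xy; apply: ge0_ler_powR => //; rewrite ?invr_ge0 ?nnegrE //.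
exact: le_trans xy.
Qed.

Lemma root_exprK k x : (0 < k)%N -> 0 <= x -> (x `^ k%:R^-1) ^+ k = x.
Proof.
move=> k0 x0; rewrite -powR_mulrn ?powR_ge0 // -powRrM mulVf ?powRr1 //.
by rewrite pnatr_eq0 -lt0n.
Qed.

Lemma expr_rootK k x : (0 < k)%N -> 0 <= x -> (x ^+ k) `^ k%:R^-1 = x.
Proof.
move=> k0 x0; rewrite -powR_mulrn // -powRrM mulfV ?powRr1 //.
by rewrite pnatr_eq0 -lt0n.
Qed.

Lemma cvg_root_cst c : 0 < c -> c `^ k%:R^-1 @[k --> \oo] --> (1 : R).
Proof.
move=> c0; rewrite /powR gt_eqF //.
have k_cvg : k%:R^-1 * ln c @[k --> \oo] --> (0 : R).
  rewrite -[X in _ --> X](mul0r (ln c)); apply: cvgM; last exact: cvg_cst.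
  by rewrite -cvg_shiftS; exact: cvg_harmonic.
rewrite -[X in _ --> X]expR0.
exact: (continuous_cvg _ (@continuous_expR R 0) k_cvg).
Qed.

(** Fekete's argument: the limit is the infimum of the roots with k > 0. If
the p-th root of u_p is below x, write k = q p + r with r < p; then
u_k <= u_p^q u_r <= M x^k with M independent of k, so the k-th roots of u are
at most x times the k-th roots of M, which tend to 1. *)
Lemma submult_root_is_cvg u :
    (forall k, 0 <= u k) -> (forall j k, u (j + k)%N <= u j * u k) ->
  cvgn (fun k => u k `^ k%:R^-1).
Proof.
move=> u0 uM.
pose E := [set u k `^ k%:R^-1 | k in [set k | (0 < k)%N]].
have Einf : has_inf E.
  split; first by exists (u 1%N `^ 1%:R^-1); exists 1%N.
  by exists 0 => _ [k _ <-]; exact: powR_ge0.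
apply/cvg_ex; exists (inf E); apply/cvgrPdist_lt => e e0.
have e20 : 0 < e / 2 by rewrite divr_gt0.
have [_ [p /= p0 <-] lt_p] := inf_adherent e20 Einf.
set x := inf E + e / 2 in lt_p.
have x0 : 0 < x by apply: le_lt_trans lt_p; exact: powR_ge0.
have u_p : u p <= x ^+ p.
  by rewrite -(root_exprK p0 (u0 p)) lerXn2r ?nnegrE ?powR_ge0 // ltW.
have u_pq q r : u (q * p + r)%N <= x ^+ (q * p) * u r.
  elim: q => [|q IHq]; first by rewrite expr0 mul1r.
  rewrite mulSn -addnA exprD -mulrA (le_trans (uM _ _)) //.
  by rewrite ler_pM // exprn_ge0 // ltW.
(* Since x may be less than 1, the missing power x^r is put into M; the
   summand 1 makes M positive. *)
pose M := 1 + \sum_(r < p) u r / x ^+ r.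
have M0 : 0 < M.
  rewrite ltr_pwDl // sumr_ge0 // => r _.
  by rewrite divr_ge0 // exprn_ge0 // ltW.
have u_le k : u k <= x ^+ k * M.
  rewrite {1 2}(divn_eq k p) (le_trans (u_pq _ _)) // exprD -mulrA.
  rewrite ler_pM2l ?exprn_gt0 // mulrC -ler_pdivrMr ?exprn_gt0 //.
  have lt_r : (k %% p < p)%N by rewrite ltn_mod.
  rewrite /M (bigD1 (Ordinal lt_r)) //= addrCA lerDl.
  rewrite addr_ge0 // sumr_ge0 // => r _.
  by rewrite divr_ge0 // exprn_ge0 // ltW.
have xM_cvg : x * M `^ k%:R^-1 @[k --> \oo] --> x.
  rewrite -[X in _ --> X]mulr1.
  by apply: cvgM; [exact: cvg_cst | exact: cvg_root_cst].
have lt_x : x < inf E + e by rewrite ltrD2l ltr_pdivrMr // ltr_pMr // ltr1n.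
near=> k.
have k0 : (0 < k)%N by near: k; exact: nbhs_infty_gt.
rewrite distrC ger0_norm; last first.
  by rewrite subr_ge0; apply: ge_inf; [case: Einf | exists k].
rewrite ltrBlDl; apply: (@le_lt_trans _ _ (x * M `^ k%:R^-1)).
  rewrite -{1}(expr_rootK k0 (ltW x0)) -powRM ?exprn_ge0 //; [|exact: ltW..].
  exact: ler_root.
near: k; exact: (cvgr_lt x xM_cvg).
Unshelve. all: by end_near. Qed.

Lemma le_limn_sup u v : bounded_fun u -> bounded_fun v ->
  (forall k, u k <= v k) -> limn_sup u <= limn_sup v.
Proof.
move=> bu bv uv.
have sups_cvg (w : nat -> R) : bounded_fun w -> cvgn (sups w).
  move=> bw; apply: nonincreasing_is_cvgn; last first.
    exact: bounded_fun_has_lbound_sups.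
  exact/nonincreasing_sups/bounded_fun_has_ubound.
apply: ler_lim; [exact: sups_cvg..|apply: nearW => k].
apply: ge_sup; first by exists (u k); exists k => /=.
move=> _ [j /= kj <-]; apply: le_trans (uv j) _.
apply: ub_le_sup; last by exists j.
exact/has_ubound_sdrop/bounded_fun_has_ubound.
Qed.

End Roots.

(** * Words in the matrices and powers of their sum *)

Section Words.
Variables (R : realType) (n m : nat) (A : 'I_m -> 'M[R]_n).

Lemma word_prod_nil : word_prod A [::] = 1.
Proof. by rewrite /word_prod big_nil. Qed.

Lemma word_prod_cons i s : word_prod A (i :: s) = word_prod A s * A i.
Proof. by rewrite /word_prod rev_cons big_rcons. Qed.

(** The multinomial expansion without commutativity. A new factor of the power
is multiplied on the right, where the first letter of a word stands: prefixing
a letter to a word of length k enumerates the words of length k + 1. *)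
Lemma expr_sum_words k :
  (\sum_(i < m) A i) ^+ k = \sum_(s : k.-tuple 'I_m) word_prod A s.
Proof.
elim: k => [|k IHk].
  rewrite expr0 (bigD1 [tuple]) //= word_prod_nil big1 ?addr0 // => s /eqP[].
  by rewrite [s]tuple0.
pose cons_word (p : 'I_m * k.-tuple 'I_m) := [tuple of p.1 :: p.2].
have consK : bijective cons_word.
  exists (fun s => (thead s, [tuple of behead s])) => [[i s]|s] /=.
    by congr pair; apply: val_inj.
  by rewrite [RHS]tuple_eta; apply: val_inj.
rewrite exprSr IHk mulr_suml (reindex cons_word) /=; last exact: onW_bij.
under [RHS]eq_bigr do rewrite word_prod_cons.
rewrite -(pair_bigA _ (fun i (s : k.-tuple 'I_m) => word_prod A s * A i)).
rewrite exchange_big /=.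
by apply: eq_bigr => s _; rewrite mulr_sumr.
Qed.

Hypothesis A_ge0 : forall i (p q : 'I_n), 0 <= A i p q.

Lemma word_prod_ge0 s p q : 0 <= word_prod A s p q.
Proof.
elim: s p q => [|i s IHs] p q.
  by rewrite word_prod_nil mxE ler0n.
by rewrite word_prod_cons mxE sumr_ge0 // => r _; rewrite mulr_ge0.
Qed.

(** The word s is one of the terms of the expansion of the power, and the
other terms are non-negative. *)
Lemma word_prod_le_expr_sum k (s : k.-tuple 'I_m) p q :
  word_prod A s p q <= ((\sum_(i < m) A i) ^+ k) p q.
Proof.
rewrite expr_sum_words summxE (bigD1 s) //= lerDl sumr_ge0 // => t _.
exact: word_prod_ge0.
Qed.
End Words.

(** * Equivalence of matrix norms *)

Section EntryNorm.
Variable R : realType.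

Lemma entry_le_mx_norm p q (A : 'M[R]_(p, q)) i j : `|A i j| <= `|A|.
Proof.
rewrite [leRHS]mx_normrE.
exact: (le_bigmax 0 (fun ij : 'I_p * 'I_q => `|A ij.1 ij.2|) (i, j)).
Qed.

Lemma mx_norm_le p q (A : 'M[R]_(p, q)) x : 0 <= x ->
  (forall i j, `|A i j| <= x) -> `|A| <= x.
Proof. by move=> x0 Ax; rewrite [leLHS]mx_normrE bigmax_le // => -[]. Qed.

(** This isometry lets the compactness of the unit sphere be used for row
vectors and carried to square matrices. *)
Lemma mx_norm_vec_mx p q (v : 'rV[R]_(p * q)) : `|vec_mx v| = `|v|.
Proof.
apply/eqP; rewrite eq_le; apply/andP; split; apply: mx_norm_le => // i j.
  by rewrite mxE entry_le_mx_norm.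
case/mxvec_indexP: j => a b.
by rewrite ord1 -{1}[v]vec_mxK mxvecE entry_le_mx_norm.
Qed.

End EntryNorm.

Section NormEquivalence.
Variables (R : realType) (n : nat) (N : 'M[R]_n -> R) (hN : is_mxnorm N).

Lemma mxnorm0 : N 0 = 0.
Proof. by case: hN => _ NZ _; rewrite -(scale0r 0) NZ normr0 mul0r. Qed.

Lemma mxnormN A : N (- A) = N A.
Proof. by case: hN => _ NZ _; rewrite -scaleN1r NZ normrN1 mul1r. Qed.

(** From 0 = N(A - A) <= 2 N(A). *)
Lemma mxnorm_ge0 A : 0 <= N A.
Proof.
case: hN => ND _ _; rewrite -(pmulrn_lge0 _ (isT : 0 < 2)%N) mulr2n.
by rewrite -{2}mxnormN -mxnorm0 -(subrr A) ND.
Qed.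

Lemma mxnorm_sum I (r : seq I) (F : I -> 'M[R]_n) :
  N (\sum_(i <- r) F i) <= \sum_(i <- r) N (F i).
Proof.
case: hN => ND _ _; elim/big_ind2: _ => [|A x B y le1 le2|//].
  by rewrite mxnorm0.
exact: le_trans (ND _ _) (lerD le1 le2).
Qed.

Lemma mxnorm_dist A B : `|N A - N B| <= N (A - B).
Proof.
case: hN => ND _ _; have le_sub C D : N C - N D <= N (C - D).
  by rewrite lerBlDr (le_trans _ (ND _ _)) // subrK.
have [_|_] := ger0P (N A - N B); first exact: le_sub.
by rewrite opprB -[leRHS]mxnormN opprB le_sub.
Qed.

(** Expand A in the elementary matrices and use the triangle inequality. *)
Lemma mxnorm_le_mx_norm : exists2 c, 0 < c & forall A, N A <= c * `|A|.
Proof.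
have [_ NZ _] := hN.
(* The summand 1 makes the constant positive when n = 0. *)
exists (1 + \sum_i \sum_j N (delta_mx i j)).
  rewrite ltr_pwDl // sumr_ge0 // => i _; rewrite sumr_ge0 // => j _.
  exact: mxnorm_ge0.
move=> A; rewrite mulrDl mul1r -[leLHS]add0r lerD //.
rewrite {1}[A]matrix_sum_delta mulr_suml.
apply: le_trans (mxnorm_sum _ _) _; apply: ler_sum => i _; rewrite mulr_suml.
apply: le_trans (mxnorm_sum _ _) _; apply: ler_sum => j _.
by rewrite NZ mulrC ler_wpM2l ?mxnorm_ge0 // entry_le_mx_norm.
Qed.

Lemma continuous_mxnorm : continuous N.
Proof.
have [c c0 Nc] := mxnorm_le_mx_norm.
move=> A; apply/(@cvgrPdist_le _ _ _ (nbhs A)) => e e0.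
near=> B; apply: le_trans (mxnorm_dist _ _) _; apply: le_trans (Nc _) _.
rewrite mulrC -ler_pdivlMr //; near: B.
by apply: (@cvgr_dist_le _ _ _ (nbhs A) _ id A cvg_id); rewrite divr_gt0.
Unshelve. all: by end_near. Qed.

(** N is continuous, hence attains a minimum on the unit sphere, which is
compact; the minimum is positive because N vanishes only at 0, and it bounds
N from below everywhere by homogeneity. *)
Lemma mx_norm_le_mxnorm : exists2 c, 0 < c & forall A, `|A| <= c * N A.
Proof.
have [_ NZ N0] := hN.
pose S : set 'rV[R]_(n * n) := [set v | `|v| = 1].
have unitS (A : 'M[R]_n) : A != 0 -> S (mxvec (`|A|^-1 *: A)).
  move=> A0; rewrite /S /= -mx_norm_vec_mx mxvecK normrZ normfV normr_id.
  by rewrite mulVf // normr_eq0.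
(* The sphere is empty when n = 0; every matrix is then 0. *)
have [S0|/set0P S0] := eqVneq S set0.
  exists 1 => // A; have [->|/unitS] := eqVneq A 0.
    by rewrite normr0 mul1r mxnorm_ge0.
  by rewrite S0.
have Scompact : compact S.
  apply: bounded_closed_compact.
    by exists 1; split => // x x1 v /= ->; exact: ltW.
  rewrite (_ : S = [set v : 'rV[R]_(n * n) | `|v| = 1]) //.
  apply: (@closed_comp _ _ (fun v : 'rV[R]_(n * n) => `|v|) [set 1]).
    by move=> v _; exact: norm_continuous.
  exact: closed_eq.
have vec_mx_continuous : continuous (@vec_mx R n n).
  move=> v; apply/(@cvgrPdist_le _ _ _ (nbhs v)) => e e0; near=> w.
  rewrite -raddfB mx_norm_vec_mx; near: w.
  exact: (@cvgr_dist_le _ _ _ (nbhs v) _ id v cvg_id).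
have cts : {within S, continuous (N \o @vec_mx R n n)}.
  apply: continuous_subspaceT => v; apply: continuous_comp.
    exact: vec_mx_continuous.
  exact: continuous_mxnorm.
have [v /set_mem Sv minv] := compact_EVT_min S0 Scompact cts.
have Nv0 : 0 < N (vec_mx v).
  rewrite lt_neqAle mxnorm_ge0 andbT eq_sym; apply/eqP => /N0 v0.
  move: Sv; rewrite /S /= -mx_norm_vec_mx v0 normr0 => /esym/eqP.
  by rewrite oner_eq0.
exists (N (vec_mx v))^-1; first by rewrite invr_gt0.
move=> A; have [->|A0] := eqVneq A 0.
  by rewrite normr0 mulr_ge0 ?mxnorm_ge0 // invr_ge0 ltW.
have := minv _ (mem_set (unitS _ A0)).
by rewrite /= mxvecK NZ normfV normr_id !ler_pdivlMl ?normr_gt0 // mulrC.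
Unshelve. all: by end_near. Qed.

(** The largest-entry norm satisfies |A B| <= n |A| |B|, since each entry of
A B is a sum of n products of entries. *)
Lemma mxnorm_mulmx : exists2 c, 0 < c &
  forall A B : 'M[R]_n, N (A * B) <= c * (N A * N B).
Proof.
have [c c0 Nc] := mxnorm_le_mx_norm; have [d d0 dN] := mx_norm_le_mxnorm.
exists (c * (n.+1%:R * (d * d))); first by rewrite !mulr_gt0.
move=> A B; apply: le_trans (Nc _) _; rewrite -!mulrA ler_pM2l //.
have le_AB : `|A| * `|B| <= d * (d * (N A * N B)).
  by rewrite mulrA mulrACA ler_pM.
(* n + 1 instead of n keeps the constant positive when n = 0. *)
apply: (@le_trans _ _ (n.+1%:R * (`|A| * `|B|))); last by rewrite ler_pM2l.
apply: mx_norm_le => [|i j]; first by rewrite !mulr_ge0.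
rewrite mxE (le_trans (ler_norm_sum _ _ _)) //.
apply: (@le_trans _ _ (\sum_(k < n) `|A| * `|B|)).
  by apply: ler_sum => k _; rewrite normrM ler_pM ?entry_le_mx_norm.
rewrite sumr_const card_ord -[leLHS]mulr_natl ler_wpM2r ?mulr_ge0 //.
by rewrite ler_nat.
Qed.

(** Monotonicity up to a constant, inherited from the largest-entry norm; with
constant 1 it can fail. *)
Lemma mxnorm_monotone : exists2 c, 0 < c &
  forall A B : 'M[R]_n, (forall i j, 0 <= A i j <= B i j) -> N A <= c * N B.
Proof.
have [c c0 Nc] := mxnorm_le_mx_norm; have [d d0 dN] := mx_norm_le_mxnorm.
exists (c * d); first by rewrite mulr_gt0.
move=> A B leAB; apply: le_trans (Nc _) _; rewrite -mulrA ler_pM2l //.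
apply: le_trans (dN _); apply: mx_norm_le => // i j.
have /andP[A0 AB] := leAB i j.
rewrite ger0_norm // (le_trans AB) // (le_trans (ler_norm _)) //.
exact: entry_le_mx_norm.
Qed.

End NormEquivalence.

(** * Joint spectral radius of non-negative matrices *)

(** N itself is submultiplicative only up to a constant c, but c * N is
submultiplicative; the k-th roots of c tend to 1. *)
Lemma mxnorm_expr_root_is_cvg (R : realType) (n : nat) (N : 'M[R]_n -> R)
    (hN : is_mxnorm N) (A : 'M[R]_n) :
  cvgn (fun k => N (A ^+ k) `^ k%:R^-1).
Proof.
have [c c0 NM] := mxnorm_mulmx hN.
have cN_ge0 k : 0 <= c * N (A ^+ k) by rewrite mulr_ge0 ?mxnorm_ge0 // ltW.
have cN_submult j k :
    c * N (A ^+ (j + k)) <= c * N (A ^+ j) * (c * N (A ^+ k)).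
  by rewrite exprD -mulrA ler_pM2l // mulrCA.
have /cvg_ex[l cN_cvg] := submult_root_is_cvg cN_ge0 cN_submult.
have ci0 : 0 < c^-1 by rewrite invr_gt0.
have := cvgM cN_cvg (cvg_root_cst ci0).
rewrite (_ : _ \* _ = fun k => N (A ^+ k) `^ k%:R^-1); last first.
  apply/funext => k /=; rewrite -powRM ?cN_ge0 ?(ltW ci0) //.
  by rewrite mulrC mulKf ?gt_eqF.
by move=> /(_ eventually_filter) root_cvg; apply/cvg_ex; exists (l * 1).
Qed.

Section WordNorms.
Variables (R : realType) (n m : nat) (N : 'M[R]_n -> R) (hN : is_mxnorm N).
Variable A : 'I_m -> 'M[R]_n.

Let S := \sum_(i < m) A i.
Let a k := N (S ^+ k) `^ k%:R^-1.
Let b k := \big[Num.max/0]_(s : k.-tuple 'I_m) (N (word_prod A s) `^ k%:R^-1).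

(** N(S^k) is bounded by the sum of N over the m^k words of length k. *)
Lemma expr_root_le_max_words k : (0 < m)%N -> a k <= m%:R * b k.
Proof.
move=> m0; have b_ge0 : 0 <= b k by exact: bigmax_ge_id.
have word_le (s : k.-tuple 'I_m) : N (word_prod A s) `^ k%:R^-1 <= b k.
  exact: (le_bigmax _ (fun s : k.-tuple 'I_m => N (word_prod A s) `^ k%:R^-1)).
have [k0|k0] := posnP k.
  (* At k = 0 the exponent k^-1 is 0, so that every power is 1. *)
  have := word_le [tuple of nseq k (Ordinal m0)]; rewrite /a k0 invr0 !powRr0.
  by rewrite -k0 => b_ge1; rewrite -[leLHS]mulr1 ler_pM ?ler01 // ler1n.
rewrite -[leRHS](expr_rootK k0) ?mulr_ge0 //.
apply: ler_root; first exact: mxnorm_ge0.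
rewrite /S expr_sum_words (le_trans (mxnorm_sum hN _ _)) //.
apply: (@le_trans _ _ (\sum_(s : k.-tuple 'I_m) b k ^+ k)).
  apply: ler_sum => s _.
  rewrite -(root_exprK k0 (mxnorm_ge0 hN (word_prod A s))).
  by rewrite lerXn2r ?nnegrE ?powR_ge0.
by rewrite sumr_const card_tuple card_ord -[leLHS]mulr_natl natrX exprMn.
Qed.

(** Non-negativity enters here: each word product is entrywise between 0 and
S^k, and N is monotone up to a constant. *)
Lemma max_words_le_expr_root :
    (forall i (p q : 'I_n), 0 <= A i p q) ->
  exists2 c, 0 < c & forall k, b k <= c `^ k%:R^-1 * a k.
Proof.
move=> A_ge0; have [c c0 Nle] := mxnorm_monotone hN.
exists c => // k; apply: bigmax_le => [|s _].
  by rewrite mulr_ge0 ?powR_ge0.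
rewrite -powRM ?mxnorm_ge0 //; last exact: ltW.
apply: ler_root; first exact: mxnorm_ge0.
by apply: Nle => p q; rewrite word_prod_ge0 ?word_prod_le_expr_sum.
Qed.

End WordNorms.

Theorem corollary2 (R : realType) (n m : nat) (hm : (0 < m)%N)
    (N : 'M[R]_n -> R) (hN : is_mxnorm N)
    (A : 'I_m -> 'M[R]_n) (hA : forall i (p q : 'I_n), 0 <= A i p q) :
  m%:R^-1 * spectral_radius N (\sum_(i < m) A i) <= joint_spectral_radius N A
  /\ joint_spectral_radius N A <= spectral_radius N (\sum_(i < m) A i).
Proof.
rewrite /spectral_radius /joint_spectral_radius.
set a := fun k => N (_ ^+ k) `^ _; set b := fun k => \big[_/_]_(_ | _) _.
have a_cvg : a @ \oo --> limn a by exact: mxnorm_expr_root_is_cvg.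
have m0 : 0 < m%:R :> R by rewrite ltr0n.
have [c c0 b_le] := max_words_le_expr_root hN hA.
have lower_cvg : m%:R^-1 * a k @[k --> \oo] --> m%:R^-1 * limn a.
  by apply: cvgM => //; exact: cvg_cst.
have upper_cvg : c `^ k%:R^-1 * a k @[k --> \oo] --> limn a.
  by rewrite -[X in _ --> X]mul1r; apply: cvgM => //; exact: cvg_root_cst.
have lower_le k : m%:R^-1 * a k <= b k.
  by rewrite ler_pdivrMl //; exact: expr_root_le_max_words.
have upper_bounded : bounded_fun (fun k => c `^ k%:R^-1 * a k).
  by apply: cvg_seq_bounded; apply/cvg_ex; exists (limn a).
have b_bounded : bounded_fun b.
  have [M [Mreal upper_M]] := upper_bounded.
  exists M; split => // x Mx k _.
  rewrite /= ger0_norm; last by exact: bigmax_ge_id.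
  exact: le_trans (b_le k) (le_trans (ler_norm _) (upper_M _ Mx k I)).
split.
- rewrite -(cvg_limn_inf_sup lower_cvg).2; apply: le_limn_sup => //.
  by apply: cvg_seq_bounded; apply/cvg_ex; exists (m%:R^-1 * limn a).
- rewrite -(cvg_limn_inf_sup upper_cvg).2; exact: le_limn_sup.
Qed.
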